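(* Let $(X,\tau)$ be a topological space and let $f:X\to X$ be a bijective map such that $f(x)\neq x$ for all $x\in X$. Then, for the rough family $\mathcal{F}=\{F_x=\{x,f(x)\} : x\in X\}$, the rough closure $\overline{A}^{\mathcal{F}}$ contains more than one point for any $A\subset X$.
   Context: A rough family on a set $X$ is a collection $\mathcal{F}=\{F_x : x\in X\}$ of subsets of $X$ with $x\in F_x$ for all $x\in X$. For a topological space $(X,\tau)$, a rough family $\mathcal{F}$ on $X$ and $A\subset X$, a point $x\in X$ is a rough limit point of $A$ with roughness $\mathcal{F}$ if $(U\cap A)\setminus\{x\}\neq\emptyset$ for every $\tau$-open set $U$ with $F_x\subset U$. The rough closure of $A$ with roughness $\mathcal{F}$ is $\overline{A}^{\mathcal{F}}=A\cup A'^{\mathcal{F}}$, where $A'^{\mathcal{F}}$ is the set of all rough limit points of $A$ with roughness $\mathcal{F}$.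
   Formalization: The set A is assumed nonempty: for A empty the claim fails, since no point is a rough limit point of the empty set and its rough closure is empty. *)

(* Defs.v *)
From HB Require Import structures.
From mathcomp Require Import all_boot all_order all_classical topology.

Set Implicit Arguments.
Unset Strict Implicit.
Unset Printing Implicit Defensive.

Local Open Scope classical_set_scope.

Record rough_family (X : Type) := RoughFamily {
  rough_set :> X -> set X;
  rough_set_self : forall x, rough_set x x }.

Definition rough_limit_point (X : topologicalType) (F : rough_family X)
    (A : set X) (x : X) : Prop :=
  forall U : set X, open U -> F x `<=` U -> (U `&` A) `\ x !=set0.

Definition rough_derived (X : topologicalType) (F : rough_family X)
    (A : set X) : set X :=
  [set x | rough_limit_point F A x].

Definition rough_closure (X : topologicalType) (F : rough_family X)
    (A : set X) : set X :=
  A `|` rough_derived F A.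

Lemma pair_family_self (X : Type) (f : X -> X) (x : X) : [set x; f x] x.
Proof. by left. Qed.

Definition pair_family (X : Type) (f : X -> X) : rough_family X :=
  @RoughFamily X (fun x => [set x; f x]) (pair_family_self f).

(* Main.v *)
Require Import Defs.
From HB Require Import structures.
From mathcomp Require Import all_boot all_order all_classical topology.

(** Pick a point [a] of [A] and let [g] be the inverse of [f]. The rough set
    at [g a] is [{g a, a}], so each of its open neighbourhoods meets [A] at
    [a]. Since [f] has no fixed point, [a] differs from [g a], which makes
    [g a] a rough limit point of [A]: the closure contains both [a] and
    [g a]. *)

Set Implicit Arguments.
Unset Strict Implicit.
Unset Printing Implicit Defensive.

Local Open Scope classical_set_scope.

Theorem theorem2p4 (X : topologicalType) (f : X -> X)
    (f_bij : bijective f) (f_nofix : forall x : X, f x <> x)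
    (A : set X) (A_nonempty : A !=set0) :
  exists x y : X,
    [/\ rough_closure (pair_family f) A x,
        rough_closure (pair_family f) A y & x <> y].
Proof.
case: f_bij => g _ gK; case: A_nonempty => a Aa.
have a_neq_ga : a <> g a by move=> e; apply: (f_nofix (g a)); rewrite gK.
exists a, (g a); split=> //; first by left.
right=> U _ FU; exists a; split=> //; split=> //.
by apply: FU; right; rewrite gK.
Qed.
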